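(* Let $\Lambda\in\mathbb{R}$ and let $\rho,p,q$ be smooth real functions of a real variable $z$, defined on an open interval containing $z=0$, and write $\rho_0=\rho(0)$, $p_0=p(0)$, $q_0=q(0)$. Consider the energy-momentum tensor $(T^{\mu}_{\nu})=\mathrm{diag}\{\rho(z),-p(z),-p(z),-q(z)\}$ in coordinates $(t,x,y,z)$. Assume it is generic at $z=0$, i.e. \[ q_0\neq\Lambda \quad\text{and}\quad \big[\ \rho_0\neq q_0-2\Lambda \ \text{ or } \ \rho_0+4p_0+3q_0\neq 6\Lambda\ \big], \] and fix a constant $z_S$ with \[ \frac{q_0-\Lambda}{z_S}<0 \qquad\text{and}\qquad 3z_S(\rho_0-q_0+2\Lambda)\neq \rho_0+4p_0+3q_0-6\Lambda . \] Then there is a maximal open interval $I_0$ containing $z=0$ on which the function \[ \Phi(z)=\frac{q(z)-\Lambda}{z-z_S}\cdot\frac{1}{3(z-z_S)\big(\rho(z)-q(z)+2\Lambda\big)+\rho(z)+4p(z)+3q(z)-6\Lambda} \] is well defined and $\dfrac{q(z)-\Lambda}{z-z_S}>0$. Furthermore, the metric \[ g=e^{2\int_0^z \left(3(z'-z_S)-1\right)\Phi(z')\,dz'}\,dt^2-e^{4\int_0^z\Phi(z')\,dz'}\,(dx^2+dy^2)-\frac{12\,(z-z_S)}{q(z)-\Lambda}\,\Phi(z)^2\,dz^2, \] defined for $z\in I_0$, satisfies Einstein's equations with cosmological constant $\Lambda$, \[ R^{\mu}_{\nu}-\tfrac12 R\,\delta^{\mu}_{\nu}-\Lambda\,\delta^{\mu}_{\nu}=T^{\mu}_{\nu},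 \] provided the energy-momentum tensor is conserved, $\nabla_\mu T^{\mu}_{\nu}=0$, which (for this metric) is equivalent to \[ \frac{dq}{dz}=\Big[\big(1-3(z-z_S)\big)(\rho+q)+4(p-q)\Big]\Phi . \]
   Context: Units are chosen so that $8\pi G/c^4=1$. The metric has signature $(+,-,-,-)$. The Levi-Civita connection $\Gamma$ of $g$ is used, with Riemann tensor $R^{\lambda}{}_{\mu\kappa\nu}=\partial_\kappa\Gamma^\lambda_{\nu\mu}-\partial_\nu\Gamma^\lambda_{\kappa\mu}+\Gamma^\lambda_{\kappa\sigma}\Gamma^\sigma_{\nu\mu}-\Gamma^\lambda_{\nu\sigma}\Gamma^\sigma_{\kappa\mu}$, Ricci tensor $R_{\mu\nu}=R^{\lambda}{}_{\mu\lambda\nu}$, $R^\mu_\nu=g^{\mu\alpha}R_{\alpha\nu}$, and scalar curvature $R=R^\mu_\mu$. $\nabla$ denotes the covariant derivative of $g$. *)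

(* Defs.v *)
From HB Require Import structures.
From mathcomp Require Import all_boot all_order all_algebra.
From mathcomp Require Import all_classical all_reals all_analysis.
Set Implicit Arguments. Unset Strict Implicit. Unset Printing Implicit Defensive.
Import Order.TTheory GRing.Theory Num.Theory.
Import numFieldNormedType.Exports.
Local Open Scope classical_set_scope.
Local Open Scope ring_scope.

Section Geometry.
Variable R : realType.

(* Spacetime points: row vectors (t, x, y, z) indexed 0,1,2,3. *)
Definition pt := 'rV[R]_4.
Definition coord (x : pt) (k : 'I_4) : R := x ord0 k.
Definition zcoord (x : pt) : R := x ord0 (@Ordinal 4 3 isT).

Definition pd (k : 'I_4) (f : pt -> R) (x : pt) : R :=
  derive f x (delta_mx 0 k).

Definition ginv (g : pt -> 'M[R]_4) (x : pt) : 'M[R]_4 := invmx (g x).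

Definition Gamma (g : pt -> 'M[R]_4) (x : pt) (l m n : 'I_4) : R :=
  2^-1 * \sum_(s < 4) ginv g x l s *
    (pd m (fun y => g y s n) x + pd n (fun y => g y s m) x
     - pd s (fun y => g y m n) x).

Definition Riemann (g : pt -> 'M[R]_4) (x : pt) (l m k n : 'I_4) : R :=
  pd k (fun y => Gamma g y l n m) x - pd n (fun y => Gamma g y l k m) x
  + \sum_(s < 4) (Gamma g x l k s * Gamma g x s n m
                  - Gamma g x l n s * Gamma g x s k m).

Definition Ricci (g : pt -> 'M[R]_4) (x : pt) (m n : 'I_4) : R :=
  \sum_(l < 4) Riemann g x l m l n.

Definition RicciUp (g : pt -> 'M[R]_4) (x : pt) (m n : 'I_4) : R :=
  \sum_(a < 4) ginv g x m a * Ricci g x a n.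

Definition scalarCurv (g : pt -> 'M[R]_4) (x : pt) : R :=
  \sum_(m < 4) RicciUp g x m m.

Definition einstein_eqs (g : pt -> 'M[R]_4) (Lam : R)
    (T : pt -> 'M[R]_4) (x : pt) : Prop :=
  forall m n : 'I_4,
    RicciUp g x m n - 2^-1 * scalarCurv g x * (m == n)%:R
      - Lam * (m == n)%:R = T x m n.

Definition divT (g : pt -> 'M[R]_4) (T : pt -> 'M[R]_4) (x : pt) (n : 'I_4) : R :=
  \sum_(m < 4) pd m (fun y => T y m n) x
  + \sum_(m < 4) \sum_(s < 4)
      (Gamma g x m m s * T x s n - Gamma g x s m n * T x m s).

Definition Tmat (rho p q : R -> R) (x : pt) : 'M[R]_4 :=
  \matrix_(i < 4, j < 4)
    if i == j then
      (if val i == 0%N then rho (zcoord x)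
       else if val i == 3%N then - q (zcoord x) else - p (zcoord x))
    else 0.

Definition oint (a b : R) (f : R -> R) : R :=
  if a <= b then \int[lebesgue_measure]_(s in `[a, b]) f s
  else - \int[lebesgue_measure]_(s in `[b, a]) f s.

Definition smooth_on (a b : \bar R) (f : R -> R) : Prop :=
  forall (n : nat) (z : R), (a < z%:E < b)%E -> derivable (derive1n n f) z 1.

Definition Dden (Lam zS : R) (rho p q : R -> R) (z : R) : R :=
  3 * (z - zS) * (rho z - q z + 2 * Lam) + rho z + 4 * p z + 3 * q z - 6 * Lam.

Definition Phi (Lam zS : R) (rho p q : R -> R) (z : R) : R :=
  (q z - Lam) / (z - zS) * (Dden Lam zS rho p q z)^-1.

Definition good (a b : \bar R) (Lam zS : R) (rho p q : R -> R) (z : R) : Prop :=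
  (a < z%:E < b)%E /\ z != zS /\ Dden Lam zS rho p q z != 0
  /\ 0 < (q z - Lam) / (z - zS).

(* The metric (formula taken literally at every point; only used for z in I0) *)
Definition metric (Lam zS : R) (rho p q : R -> R) (x : pt) : 'M[R]_4 :=
  let z := zcoord x in
  let F := Phi Lam zS rho p q in
  \matrix_(i < 4, j < 4)
    if i == j then
      (if val i == 0%N then
         expR (2 * oint 0 z (fun s => (3 * (s - zS) - 1) * F s))
       else if val i == 3%N then
         - (12 * (z - zS) / (q z - Lam) * (F z) ^+ 2)
       else - expR (4 * oint 0 z F))
    else 0.

End Geometry.

(* Main.v *)
(** In a static planar metric [diag(A, -B, -B, -C)] depending on [z] only, with
    [A' = 2 alpha A], [B' = 2 beta B] and [C' = 2 gamma C], the Ricci tensor is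
    diagonal and polynomial in [alpha], [beta], [gamma], [alpha'], [beta'] up to
    the factor [1 / C].  For the given metric [alpha = (3 (z - zS) - 1) Phi],
    [beta = 2 Phi] and [gamma = (1 / (z - zS) - q' / (q - Lam)) / 2 + Phi' / Phi],
    so [Phi'] cancels from the Einstein tensor; eliminating [q'] by the
    conservation law and [Phi] by its definition leaves a rational identity. *)
Require Import Defs.
From HB Require Import structures.
From mathcomp Require Import all_boot all_order all_algebra.
From mathcomp Require Import all_classical all_reals all_analysis.
From mathcomp Require Import ring lra.
Set Implicit Arguments. Unset Strict Implicit. Unset Printing Implicit Defensive.
Import Order.TTheory GRing.Theory Num.Theory.
Import numFieldNormedType.Exports.
Local Open Scope classical_set_scope.
Local Open Scope ring_scope.

(** * Curvature and divergence for diagonal planar metrics depending on [z] only *)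

Section PlanarMetric.
Variable R : realType.
Implicit Types (x : pt R) (z : R).

Lemma sum_ord4 (V : zmodType) (F : 'I_4 -> V) :
  \sum_(i < 4) F i = F (@Ordinal 4 0 isT) + F (@Ordinal 4 1 isT)
    + F (@Ordinal 4 2 isT) + F (@Ordinal 4 3 isT).
Proof.
rewrite 3!big_ord_recr big_ord1 /=.
by do !congr (_ + _); congr F; apply: val_inj.
Qed.

(** A step along a basis vector moves [zcoord] only for index 3: the difference quotient is then
    that of [f], and otherwise it is identically zero. *)
Lemma pd_zcoord (k : 'I_4) (f : R -> R) x :
  pd k (fun y => f (zcoord y)) x =
    if val k == 3%N then derive1 f (zcoord x) else 0.
Proof.
rewrite /pd /derive; case: ifPn => k3.
- rewrite /derive1; set F := (X in lim (X @ _)); set G := (X in _ = lim (X @ _)).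
  suff -> : F = G by [].
  apply/funext => h; rewrite /F /G /=.
  by rewrite /zcoord !mxE -!val_eqE /= (eqP k3) /= mulr1.
- set F := (X in lim (X @ _)).
  have -> : F = cst 0.
    apply/funext => h; rewrite /F /=.
    rewrite /zcoord !mxE -!val_eqE /= eq_sym (negbTE k3) mulr0 add0r.
    by rewrite subrr scaler0.
  exact: lim_cst.
Qed.

Lemma near_zcoord (P : set R) x :
  (\forall z \near zcoord x, P z) -> \forall y \near x, P (zcoord y).
Proof. exact: (@coord_continuous R 1 4 0 (@Ordinal 4 3 isT) x). Qed.

(** The signature (+,-,-,-) is built in; the same pattern also encodes the mixed tensor diag(rho,
    -p, -p, -q). *)
Definition planar_diag (A B C : R) (i : nat) : R :=
  if i == 0%N then A else if i == 3%N then - C else - B.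

Definition planar_mx (A B C : R) : 'M[R]_4 :=
  \matrix_(i < 4, j < 4) if i == j then planar_diag A B C (val i) else 0.

Lemma invmx_planar (A B C : R) : A != 0 -> B != 0 -> C != 0 ->
  invmx (planar_mx A B C) = planar_mx A^-1 B^-1 C^-1.
Proof.
move=> A0 B0 C0.
have e : planar_mx A B C *m planar_mx A^-1 B^-1 C^-1 = 1%:M.
  apply/matrixP => i j; rewrite !mxE sum_ord4 !mxE.
  case: i => -[|[|[|[|i]]]] Hi //; case: j => -[|[|[|[|j]]]] Hj //;
    by rewrite -!val_eqE /planar_diag /=; field.
have [u _] := mulmx1_unit e.
by rewrite -[LHS]mulmx1 -e mulKmx.
Qed.

(* Christoffel symbols of diag(A,-B,-B,-C) when A' = 2aA, B' = 2bB, C' = 2cC. *)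
Definition planar_gamma (A B C a b c : R) (l m n : nat) : R :=
  match l, m, n with
  | 0%N, 0%N, 3%N | 0%N, 3%N, 0%N => a
  | 1%N, 1%N, 3%N | 1%N, 3%N, 1%N | 2%N, 2%N, 3%N | 2%N, 3%N, 2%N => b
  | 3%N, 0%N, 0%N => a * A / C
  | 3%N, 1%N, 1%N | 3%N, 2%N, 2%N => - (b * B / C)
  | 3%N, 3%N, 3%N => c
  | _, _, _ => 0
  end.

(** The [z]-derivative of [planar_gamma]: since A' = 2aA and C' = 2cC, differentiating aA/C brings
    the factor a' + 2a^2 - 2ac, and likewise for bB/C. *)
Definition planar_dgamma (A B C a b c da db dc : R) (l m n : nat) : R :=
  match l, m, n with
  | 0%N, 0%N, 3%N | 0%N, 3%N, 0%N => da
  | 1%N, 1%N, 3%N | 1%N, 3%N, 1%N | 2%N, 2%N, 3%N | 2%N, 3%N, 2%N => db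
  | 3%N, 0%N, 0%N => (da + 2 * a ^+ 2 - 2 * a * c) * A / C
  | 3%N, 1%N, 1%N | 3%N, 2%N, 2%N => - ((db + 2 * b ^+ 2 - 2 * b * c) * B / C)
  | 3%N, 3%N, 3%N => dc
  | _, _, _ => 0
  end.

(** The mixed components R^i_i multiplied by C. *)
Definition planar_ricci (a b c da db : R) (i : nat) : R :=
  match i with
  | 0%N => da + a ^+ 2 + 2 * a * b - a * c
  | 3%N => da + a ^+ 2 - a * c + 2 * (db + b ^+ 2 - b * c)
  | _ => db + 2 * b ^+ 2 + a * b - b * c
  end.

Variables A B C a b c : R -> R.

Let g x := planar_mx (A (zcoord x)) (B (zcoord x)) (C (zcoord x)).

(** Prescribing half the logarithmic derivatives keeps A, B, C out of the Christoffel symbols,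
    except for the ratios A/C and B/C. *)
Definition planar_regular z :=
  [/\ A z != 0, B z != 0 & C z != 0] /\
  [/\ is_derive z 1 A (2 * a z * A z), is_derive z 1 B (2 * b z * B z)
    & is_derive z 1 C (2 * c z * C z)].

Lemma derive1_planar_mx z (i j : 'I_4) : planar_regular z ->
  derive1 (fun w => planar_mx (A w) (B w) (C w) i j) z =
  planar_mx (2 * a z * A z) (2 * b z * B z) (2 * c z * C z) i j.
Proof.
move=> [_ [dA dB dC]]; rewrite derive1E.
have -> : (fun w => planar_mx (A w) (B w) (C w) i j) =
    fun w => if i == j then planar_diag (A w) (B w) (C w) (val i) else 0.
  by apply/funext => w; rewrite mxE.
rewrite mxE; case: ifPn => _; last exact: derive_cst.
by rewrite /planar_diag; case: ifPn => _; [|case: ifPn => _]; apply: derive_val.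
Qed.

Lemma Gamma_planar x (l m n : 'I_4) : planar_regular (zcoord x) ->
  Gamma g x l m n =
  (fun z => planar_gamma (A z) (B z) (C z) (a z) (b z) (c z) l m n) (zcoord x).
Proof.
move=> rx; have [[A0 B0 C0] _] := rx.
rewrite /Gamma /ginv invmx_planar //.
under eq_bigr => s _.
  rewrite (pd_zcoord m (fun z => planar_mx (A z) (B z) (C z) s n)).
  rewrite (pd_zcoord n (fun z => planar_mx (A z) (B z) (C z) s m)).
  rewrite (pd_zcoord s (fun z => planar_mx (A z) (B z) (C z) m n)).
  rewrite !derive1_planar_mx //.
  over.
rewrite sum_ord4 !mxE /=.
case: l => -[|[|[|[|l]]]] Hl //; case: m => -[|[|[|[|m]]]] Hm //;
  case: n => -[|[|[|[|n]]]] Hn //;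
  by rewrite -!val_eqE /planar_diag /=; field.
Qed.

(** Only [a] and [b] are assumed differentiable: the entry (3,3,3) carries [derive1 c] as a formal
    value, which cancels later in the Ricci tensor. *)
Lemma pd_Gamma_planar x (k l m n : 'I_4) (da db : R) :
  (\forall z \near zcoord x, planar_regular z) ->
  is_derive (zcoord x) 1 a da -> is_derive (zcoord x) 1 b db ->
  pd k (fun y => Gamma g y l m n) x =
  if val k == 3%N then
    (fun z => planar_dgamma (A z) (B z) (C z) (a z) (b z) (c z) da db (derive1 c z)
      l m n) (zcoord x)
  else 0.
Proof.
move=> rx ha hb.
pose G z := planar_gamma (A z) (B z) (C z) (a z) (b z) (c z) l m n.
(* A derivative sees only values near [x], where the closed form of the symbols holds. *)
have -> : pd k (fun y => Gamma g y l m n) x = pd k (fun y => G (zcoord y)) x.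
  apply: near_eq_derive; near=> y; apply: Gamma_planar; near: y.
  exact: near_zcoord.
rewrite (pd_zcoord k G) {}/G; case: ifP => // _.
have [[A0 B0 C0] [dA dB dC]] := nbhs_singleton rx.
have dCV := is_deriveV C0 dC.
move: (zcoord x) ha hb A0 B0 C0 dA dB dC dCV => z ha hb A0 B0 C0 dA dB dC dCV.
have dtt : is_derive z 1 (fun z => a z * A z / C z)
    ((da + 2 * a z ^+ 2 - 2 * a z * c z) * A z / C z).
  apply: is_derive_eq; rewrite /= /GRing.scale /=; by field.
have dxx : is_derive z 1 (fun z => - (b z * B z / C z))
    (- ((db + 2 * b z ^+ 2 - 2 * b z * c z) * B z / C z)).
  apply: is_derive_eq; rewrite /= /GRing.scale /=; by field.
have dcst : derive1 (fun=> 0 : R) z = 0 by rewrite derive1E; exact: derive_cst.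
case: l => -[|[|[|[|l]]]] Hl //; case: m => -[|[|[|[|m]]]] Hm //;
  case: n => -[|[|[|[|n]]]] Hn //=; rewrite ?dcst // derive1E; exact: derive_val.
Unshelve. all: by end_near. Qed.

(** The value [derive1 c] enters only through R^3_333, where it is subtracted from itself. What
    remains is a rational identity for each of the sixteen index pairs. *)
Lemma RicciUp_planar x (m n : 'I_4) (da db : R) :
  (\forall z \near zcoord x, planar_regular z) ->
  is_derive (zcoord x) 1 a da -> is_derive (zcoord x) 1 b db ->
  RicciUp g x m n =
  if m == n then (fun z => planar_ricci (a z) (b z) (c z) da db m / C z)
    (zcoord x) else 0.
Proof.
move=> rx ha hb; have rz := nbhs_singleton rx; have [[A0 B0 C0] _] := rz.
rewrite /RicciUp /ginv invmx_planar //.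
under eq_bigr => s _.
  rewrite /Ricci.
  under eq_bigr => l _.
    rewrite /Riemann.
    under eq_bigr => t _ do rewrite !Gamma_planar //.
    rewrite !(@pd_Gamma_planar _ _ _ _ _ da db) //.
    rewrite sum_ord4.
    over.
  rewrite sum_ord4.
  over.
rewrite sum_ord4 !mxE.
case: m => -[|[|[|[|m]]]] Hm //; case: n => -[|[|[|[|n]]]] Hn //;
  by rewrite -!val_eqE /planar_diag /=; field; rewrite ?A0 ?B0 ?C0.
Qed.

(** The partial derivatives contribute only -q', at n = 3. There the two connection terms containing
    Gamma^3_33 cancel, so [c] is absent. *)
Lemma divT_planar x (rho p q : R -> R) (n : 'I_4) :
  planar_regular (zcoord x) -> derivable q (zcoord x) 1 ->
  divT g (Tmat rho p q) x n =
  if val n == 3%N then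
    (fun z => - derive1 q z - a z * (rho z + q z) + 2 * b z * (p z - q z)) (zcoord x)
  else 0.
Proof.
move=> rz dq; have [[A0 B0 C0] _] := rz.
have TE y : Tmat rho p q y =
    planar_mx (rho (zcoord y)) (p (zcoord y)) (q (zcoord y)) by [].
rewrite /divT.
under eq_bigr => m _.
  rewrite (pd_zcoord m (fun z => planar_mx (rho z) (p z) (q z) m n)).
  over.
under [X in _ + X = _]eq_bigr => m _.
  under eq_bigr => s _ do rewrite !Gamma_planar // TE.
  rewrite sum_ord4.
  over.
have d3 (i j : 'I_4) : val i = 3%N ->
    derive1 (fun z => planar_mx (rho z) (p z) (q z) i j) (zcoord x) =
    if i == j then - derive1 q (zcoord x) else 0.
  move=> i3; have [<-|ij] := eqVneq i j.
    rewrite (_ : (fun z => _) = - q) ?derive1E ?deriveN //.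
    by apply/funext => z; rewrite mxE eqxx i3.
  rewrite derive1E (_ : (fun z => _) = cst 0) ?derive_cst //.
  by apply/funext => z; rewrite mxE (negbTE ij).
rewrite !sum_ord4 /= d3 //.
case: n => -[|[|[|[|n]]]] Hn //;
  by rewrite !mxE -!val_eqE /planar_diag /=; field.
Qed.

End PlanarMetric.

(** * Maximal intervals with extended real endpoints, and differentiation of oriented integrals *)

Section RealIntervals.
Variable R : realType.
Implicit Types (l u : \bar R) (x z : R).

Lemma lte_EFin_lt l x : (l < x%:E)%E -> exists2 c, (l < c%:E)%E & c < x.
Proof.
case: l => [r| |] //.
- rewrite lte_fin => rx; exists ((r + x) / 2); rewrite ?lte_fin; lra.
- by exists (x - 1); [exact: ltNyr | lra].
Qed.

Lemma EFin_lt_lte u x : (x%:E < u)%E -> exists2 d, (d%:E < u)%E & x < d.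
Proof.
case: u => [r| |] //.
- rewrite lte_fin => rx; exists ((r + x) / 2); rewrite ?lte_fin; lra.
- by exists (x + 1); [exact: ltry | lra].
Qed.

Lemma near_lte_itv l u z : (l < z%:E < u)%E ->
  \forall w \near z, (l < w%:E < u)%E.
Proof.
move=> /andP[/lte_EFin_lt[c lc cz] /EFin_lt_lte[d du zd]].
near=> w; apply/andP; split.
- apply: (lt_trans lc); rewrite lte_fin; near: w; exact: lt_nbhsr.
- apply: (lt_trans _ du); rewrite lte_fin; near: w; exact: lt_nbhsl.
Unshelve. all: by end_near. Qed.

(** The two sides of 0 are independent: [L] and [U] collect the admissible left and right endpoints.
    Their infimum and supremum are admissible too, since a point strictly inside them is already
    strictly inside some admissible endpoint. *)
Lemma maximal_interval (P : R -> Prop) : (\forall z \near (0 : R), P z) ->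
  exists l u : \bar R, (l < 0%:E < u)%E
    /\ (forall z : R, (l < z%:E < u)%E -> P z)
    /\ (forall l' u' : \bar R, (l' < 0%:E < u')%E ->
          (forall z : R, (l' < z%:E < u')%E -> P z) ->
          (l <= l')%E /\ (u' <= u)%E).
Proof.
move=> /nbhs_ballP[e /= e0 he].
have {}he z : `|z| < e -> P z.
  by move=> ze; apply: he; rewrite /ball /= sub0r normrN.
pose L := [set l | forall z, z <= 0 -> (l < z%:E)%E -> P z].
pose U := [set u | forall z, 0 <= z -> (z%:E < u)%E -> P z].
exists (ereal_inf L), (ereal_sup U); split; [|split].
- apply/andP; split.
  + apply: (@le_lt_trans _ _ (- e)%:E); last by rewrite lte_fin; lra.
    apply: ereal_inf_lbound => z z0; rewrite lte_fin => ez.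
    by apply: he; rewrite ler0_norm //; lra.
  + apply: (@lt_le_trans _ _ e%:E); first by rewrite lte_fin.
    apply: ereal_sup_ubound => z z0; rewrite lte_fin => ez.
    by apply: he; rewrite ger0_norm.
- move=> z /andP[lz zu]; have [z0|z0] := leP z 0.
  + by have [l Ll lt] := ereal_inf_lt lz; exact: (Ll z).
  + by have [u Uu lt] := ereal_sup_gt zu; apply: (Uu z) => //; exact: ltW.
- move=> l' u' /andP[l0 u0] h; split.
  + apply: ereal_inf_lbound => z z0 lz; apply: h; rewrite lz /=.
    by apply: le_lt_trans u0; rewrite lee_fin.
  + apply: ereal_sup_ubound => z z0 zu; apply: h; rewrite zu andbT.
    by apply: (lt_le_trans l0); rewrite lee_fin.
Qed.

(** The fundamental theorem of calculus is applied from a base point [c] to the left of both 0 and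
    [z]; near [z], [oint 0 w f] differs from the integral over [c, w] by the constant [k], whatever
    the sign of [w]. *)
Lemma is_derive_oint l u (f : R -> R) z : (l < 0%:E < u)%E ->
  (forall w, (l < w%:E < u)%E -> derivable f w 1) -> (l < z%:E < u)%E ->
  is_derive z 1 (fun w => oint 0 w f) (f z).
Proof.
move=> /andP[l0 u0] df /andP[lz zu].
have [c lc /andP[c0 cz]] : exists2 c, (l < c%:E)%E & (c < 0) && (c < z).
  have /lte_EFin_lt[c lc] : (l < (Num.min 0 z)%:E)%E by rewrite /Num.min; case: ifP.
  by rewrite lt_min => h; exists c.
have [d du /andP[d0 zd]] : exists2 d, (d%:E < u)%E & (0 < d) && (z < d).
  have /EFin_lt_lte[d du] : ((Num.max 0 z)%:E < u)%E by rewrite /Num.max; case: ifP.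
  by rewrite gt_max => h; exists d.
have inI w : c <= w -> w <= d -> (l < w%:E < u)%E.
  move=> cw wd; apply/andP; split.
    by apply: (lt_le_trans lc); rewrite lee_fin.
  by apply: le_lt_trans du; rewrite lee_fin.
have fint (x y : R) : c <= x -> y <= d ->
    lebesgue_measure.-integrable `[x, y] (EFin \o f).
  move=> cx yd; apply: continuous_compact_integrable; first exact: segment_compact.
  apply: derivable_within_continuous => w; rewrite in_itv /= => /andP[xw wy].
  by apply: df; apply: inI; lra.
have fz : {for z, continuous f}.
  apply/differentiable_continuous/derivable1_diffP.
  by apply: df; rewrite lz zu.
have [dF FE] := continuous_FTC1_closed zd (fint c d (lexx _) (lexx _)) cz fz.
pose k := \int[lebesgue_measure]_(s in `[c, 0]) f s.
have addI (x y : R) : c <= x -> x <= y -> y <= d ->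
    \int[lebesgue_measure]_(s in `[x, y]) f s =
    \int[lebesgue_measure]_(s in `[c, y]) f s
    - \int[lebesgue_measure]_(s in `[c, x]) f s.
  (* The difference is an integral over a half-open interval; the missing endpoint has measure
     zero. *)
  move=> cx xy yd; rewrite Rintegral_itvB ?bnd_simp //; last exact: fint.
  rewrite Rintegral_itv_obnd_cbnd //; apply: integrableS (fint x y cx yd) => //.
  by apply: subset_itvr; rewrite bnd_simp.
apply: (@near_eq_is_derive _ _ _
    (fun w => \int[lebesgue_measure]_(s in `[c, w]) f s - k)); last first.
  rewrite -[f z]subr0; apply: is_deriveB.
  by apply: DeriveDef => //; rewrite -derive1E.
near=> w.
have cw : c < w by near: w; exact: lt_nbhsr.
have wd : w < d by near: w; exact: lt_nbhsl.
rewrite /oint /k; case: leP => w0.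
- by rewrite (addI 0 w) //; exact: ltW.
- by rewrite (addI w 0) ?opprB //; exact: ltW.
Unshelve. all: by end_near. Qed.

End RealIntervals.

(** * The pointwise rational identity behind Einstein's equations, with [W] standing for z - zS *)

Lemma planar_einstein_scalar (R : realType)
    (Lam rho p q W D F dF dq C : R) (i : nat) :
  W != 0 -> q - Lam != 0 -> D != 0 -> (i < 4)%N ->
  D = 3 * W * (rho - q + 2 * Lam) + rho + 4 * p + 3 * q - 6 * Lam ->
  F = (q - Lam) / W * D^-1 ->
  C = 12 * W / (q - Lam) * F ^+ 2 ->
  dq = ((1 - 3 * W) * (rho + q) + 4 * (p - q)) * F ->
  let ric := planar_ricci ((3 * W - 1) * F) (2 * F)
    (2^-1 * (W^-1 - dq / (q - Lam)) + dF / F)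
    (3 * F + (3 * W - 1) * dF) (2 * dF) in
  ric i / C - 2^-1 * (ric 0 / C + ric 1 / C + ric 2 / C + ric 3 / C) - Lam
  = planar_diag rho p q i.
Proof.
move=> W0 Q0 D0 i4 hD hF hC hdq.
(* Trading [p] for [D] makes the denominator of [F] a free nonzero variable. [dF] disappears because
   it enters only through a' - ac and b' - bc, with [a] and [b] proportional to [F]. *)
have hp : p = (D - 3 * W * (rho - q + 2 * Lam) - rho - 3 * q + 6 * Lam) / 4.
  by rewrite hD; field.
rewrite /planar_ricci /planar_diag hC hdq hF hp.
move: i4; case: i => [|[|[|[|i]]]] // _ /=; by field; rewrite W0 Q0 D0.
Qed.

(** * The given metric as a planar metric on an interval of good points *)

Section Solution.
Variables (R : realType) (Lam zS : R) (a b : \bar R) (rho p q : R -> R).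
Hypotheses (hrho : smooth_on a b rho) (hp : smooth_on a b p)
  (hq : smooth_on a b q).

Let F := Phi Lam zS rho p q.
Let D := Dden Lam zS rho p q.
Let A z := expR (2 * oint 0 z (fun s => (3 * (s - zS) - 1) * F s)).
Let B z := expR (4 * oint 0 z F).
Let C z := 12 * (z - zS) / (q z - Lam) * F z ^+ 2.
Let al z := (3 * (z - zS) - 1) * F z.
Let be z := 2 * F z.
Let ga z := 2^-1 * ((z - zS)^-1 - derive1 q z / (q z - Lam))
  + derive1 F z / F z.

Lemma smooth_on_derivable (f : R -> R) z : smooth_on a b f ->
  (a < z%:E < b)%E -> derivable f z 1.
Proof. by move=> + az => /(_ 0%N z az). Qed.

Lemma derivable_Dden z : (a < z%:E < b)%E -> derivable D z 1.
Proof.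
move=> abz.
have dr := derivableP (smooth_on_derivable hrho abz).
have dp := derivableP (smooth_on_derivable hp abz).
have dq := derivableP (smooth_on_derivable hq abz).
exact: ex_derive.
Qed.

Let good z := good a b Lam zS rho p q z.

Lemma good_neq0 z : good z ->
  [/\ z - zS != 0, q z - Lam != 0, D z != 0 & F z != 0].
Proof.
move=> [_ [zz [Dz pos]]].
have W0 : z - zS != 0 by rewrite subr_eq0.
have Q0 : q z - Lam != 0.
  by apply: contraTneq pos => ->; rewrite mul0r ltxx.
by split=> //; rewrite /F /Phi !mulf_neq0 ?invr_eq0.
Qed.

Lemma derivable_q_ratio z : good z ->
  derivable (fun w => (q w - Lam) / (w - zS)) z 1.
Proof.
move=> gz; have [W0 _ _ _] := good_neq0 gz; have [abz _] := gz.
have dq := derivableP (smooth_on_derivable hq abz).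
have dW : is_derive z 1 (fun w => w - zS) 1 by apply: is_derive_eq; rewrite subr0.
have dV := @is_deriveV _ (fun w => w - zS) _ _ _ W0 dW.
exact: ex_derive.
Qed.

Lemma derivable_Phi z : good z -> derivable F z 1.
Proof.
move=> gz; have [_ _ D0 _] := good_neq0 gz; have [abz _] := gz.
have dQ := derivableP (derivable_q_ratio gz).
have dV := is_deriveV D0 (derivableP (derivable_Dden abz)).
rewrite /F /Phi; exact: ex_derive.
Qed.

(** Each condition is open by continuity, which supplies the neighbourhood of 0 needed for a maximal
    interval. *)
Lemma near_good z : good z -> \forall w \near z, good w.
Proof.
move=> gz; have [abz [zz [Dz pos]]] := gz.
have [W0 Q0 _ _] := good_neq0 gz.
have cvg (f : R -> R) : derivable f z 1 -> f w @[w --> z] --> f z.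
  by move=> /derivable1_diffP/differentiable_continuous.
have dQ := derivable_q_ratio gz.
near=> w.
have wpos : 0 < (q w - Lam) / (w - zS).
  by near: w; apply: (cvgr_gt ((q z - Lam) / (z - zS))) => //; exact: cvg dQ.
split; [|split; [|split]] => //.
- by near: w; exact: near_lte_itv.
(* At w = zS the quotient would be 0 by the convention on inverses, against its positivity. *)
- by apply: contraTneq wpos => ->; rewrite subrr invr0 mulr0 ltxx.
- by near: w; apply: (cvgr_neq0 (D z)) => //; apply: cvg; exact: derivable_Dden.
Unshelve. all: by end_near. Qed.

Variables l u : \bar R.
Hypotheses (lu0 : (l < 0%:E < u)%E)
  (lu_good : forall z : R, (l < z%:E < u)%E -> good z).

(** [A] and [B] are exponentials of oriented integrals, so their logarithmic derivatives are the
    integrands times constants; [C] is differentiated by the product and quotient rules. *)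
Lemma metric_planar_regular z : (l < z%:E < u)%E ->
  planar_regular A B C al be ga z.
Proof.
move=> luz; have gz := lu_good luz; have [W0 Q0 D0 F0] := good_neq0 gz.
have [abz _] := gz.
have dF := derivable_Phi gz; have dq := smooth_on_derivable hq abz.
have dFI w : (l < w%:E < u)%E -> derivable F w 1.
  by move=> /lu_good/derivable_Phi.
split.
  split; [by rewrite gt_eqF ?expR_gt0 | by rewrite gt_eqF ?expR_gt0 |].
  by rewrite /C !mulf_neq0 ?invr_eq0 ?pnatr_eq0 ?expf_neq0.
have dal w : (l < w%:E < u)%E -> derivable al w 1.
  by move=> /dFI/derivableP dFw; rewrite /al; exact: ex_derive.
have iA := is_derive_oint lu0 dal luz.
have iB := is_derive_oint lu0 dFI luz.
split.
- have h : is_derive z 1 (fun w => 2 * oint 0 w al) (2 * al z).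
    by apply: is_derive_eq; rewrite /GRing.scale /=; ring.
  have := @is_derive1_comp _ expR (fun w => 2 * oint 0 w al) _ _ _
    (is_derive_expR _) h.
  by rewrite [expR _ * _]mulrC.
- have h : is_derive z 1 (fun w => 4 * oint 0 w F) (4 * F z).
    by apply: is_derive_eq; rewrite /GRing.scale /=; ring.
  have := @is_derive1_comp _ expR (fun w => 4 * oint 0 w F) _ _ _
    (is_derive_expR _) h.
  rewrite [expR _ * _]mulrC /be (_ : 2 * (2 * F z) = 4 * F z) //; ring.
- have iF : is_derive z 1 F (derive1 F z) by rewrite derive1E; exact: derivableP.
  have iq : is_derive z 1 q (derive1 q z) by rewrite derive1E; exact: derivableP.
  have iQ : is_derive z 1 (fun w => q w - Lam) (derive1 q z).
    by apply: is_derive_eq; rewrite subr0.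
  have iV := @is_deriveV _ (fun w => q w - Lam) _ _ _ Q0 iQ.
  have iF2 : is_derive z 1 (fun w => F w * F w) (2 * F z * derive1 F z).
    by apply: is_derive_eq; rewrite /GRing.scale /=; ring.
  apply: is_derive_eq; rewrite /C /ga /GRing.scale /=; field.
  by rewrite W0 Q0 F0.
Qed.

Lemma divT_metric x (n : 'I_4) : (l < (zcoord x)%:E < u)%E ->
  divT (metric Lam zS rho p q) (Tmat rho p q) x n =
  if val n == 3%N then
    (fun z => ((1 - 3 * (z - zS)) * (rho z + q z) + 4 * (p z - q z)) * F z
      - derive1 q z) (zcoord x)
  else 0.
Proof.
move=> lux; have [abx _] := lu_good lux.
have := divT_planar rho p n (metric_planar_regular lux)
  (smooth_on_derivable hq abx).
(* [metric] is convertible to the planar matrix of [A], [B], [C]. *)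
rewrite -[X in divT X]/(metric Lam zS rho p q) => ->.
by case: ifP => // _; rewrite /al /be /=; ring.
Qed.

Lemma conservation_iff_ode :
  (forall x : pt R, (l < (zcoord x)%:E < u)%E ->
    forall n : 'I_4, divT (metric Lam zS rho p q) (Tmat rho p q) x n = 0) <->
  (forall z : R, (l < z%:E < u)%E -> derive1 q z =
     ((1 - 3 * (z - zS)) * (rho z + q z) + 4 * (p z - q z)) * F z).
Proof.
split=> [h z luz|h x lux n].
(* Any spacetime point with last coordinate [z] would do; the constant row is one. *)
- have zE : zcoord (const_mx z : pt R) = z by rewrite /zcoord mxE.
  have := h (const_mx z) _ (@Ordinal 4 3 isT).
  rewrite divT_metric zE // => /(_ luz)/eqP.
  by rewrite subr_eq0 => /eqP.
- by rewrite divT_metric //=; case: ifP => // _; rewrite h // subrr.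
Qed.

Lemma einstein_metric :
  (forall z : R, (l < z%:E < u)%E -> derive1 q z =
     ((1 - 3 * (z - zS)) * (rho z + q z) + 4 * (p z - q z)) * F z) ->
  forall x : pt R, (l < (zcoord x)%:E < u)%E ->
  einstein_eqs (metric Lam zS rho p q) Lam (Tmat rho p q) x.
Proof.
move=> ode x lux m n.
have gx := lu_good lux; have [W0 Q0 D0 F0] := good_neq0 gx.
(* Regularity on a neighbourhood is required because curvature differentiates the Christoffel
   symbols. *)
have rx : \forall z \near zcoord x, planar_regular A B C al be ga z.
  near=> z; apply: metric_planar_regular; near: z; exact: near_lte_itv.
have iF : is_derive (zcoord x) 1 F (derive1 F (zcoord x)).
  by rewrite derive1E; apply: derivableP; exact: derivable_Phi.
have ial : is_derive (zcoord x) 1 al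
    (3 * F (zcoord x) + (3 * (zcoord x - zS) - 1) * derive1 F (zcoord x)).
  by apply: is_derive_eq; rewrite /GRing.scale /=; ring.
have ibe : is_derive (zcoord x) 1 be (2 * derive1 F (zcoord x)).
  by apply: is_derive_eq; rewrite /GRing.scale /=; ring.
have ricE i j := RicciUp_planar i j rx ial ibe.
rewrite -[X in RicciUp X]/(metric Lam zS rho p q) in ricE.
rewrite /scalarCurv sum_ord4 !ricE /= mxE.
case: eqP => [_|_]; last by rewrite !mulr0 !subr0.
rewrite !mulr1.
exact: (planar_einstein_scalar _ W0 Q0 D0 (ltn_ord m) erefl erefl erefl
  (ode _ lux)).
Unshelve. all: by end_near. Qed.

End Solution.

(** * Existence of the maximal interval and assembly of the result *)

Theorem theorem1 (R : realType) (Lam : R) (a b : \bar R) (rho p q : R -> R)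
  (hab : (a < 0%:E < b)%E)
  (hrho : smooth_on a b rho) (hp : smooth_on a b p) (hq : smooth_on a b q)
  (hgen1 : q 0 != Lam)
  (hgen2 : (rho 0 != q 0 - 2 * Lam) \/ (rho 0 + 4 * p 0 + 3 * q 0 != 6 * Lam))
  (zS : R)
  (hzS1 : (q 0 - Lam) / zS < 0)
  (hzS2 : 3 * zS * (rho 0 - q 0 + 2 * Lam) != rho 0 + 4 * p 0 + 3 * q 0 - 6 * Lam) :
  exists l u : \bar R,
    (l < 0%:E < u)%E
    /\ (forall z : R, (l < z%:E < u)%E -> good a b Lam zS rho p q z)
    /\ (forall l' u' : \bar R, (l' < 0%:E < u')%E ->
          (forall z : R, (l' < z%:E < u')%E -> good a b Lam zS rho p q z) ->
          (l <= l')%E /\ (u' <= u)%E)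
    /\ let g := metric Lam zS rho p q in
       let T := Tmat rho p q in
       (* conservation on I0 is equivalent to the ODE for q on I0 *)
       ((forall x : pt R, (l < (zcoord x)%:E < u)%E ->
           forall n : 'I_4, divT g T x n = 0)
        <->
        (forall z : R, (l < z%:E < u)%E ->
           derive1 q z =
             ((1 - 3 * (z - zS)) * (rho z + q z) + 4 * (p z - q z))
               * Phi Lam zS rho p q z))
       /\
       (* provided conservation holds, Einstein's equations hold on I0 *)
       ((forall x : pt R, (l < (zcoord x)%:E < u)%E ->
           forall n : 'I_4, divT g T x n = 0) ->
        forall x : pt R, (l < (zcoord x)%:E < u)%E -> einstein_eqs g Lam T x).
Proof.
have zS0 : zS != 0.
  by apply: contraTneq hzS1 => ->; rewrite invr0 mulr0 ltxx.
(* At z = 0 the factor z - zS is -zS, so [hzS1] gives the positivity condition and [hzS2] says that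
   [Dden] is nonzero. *)
have good0 : good a b Lam zS rho p q 0.
  split => //; split; first by rewrite eq_sym.
  split; last by rewrite sub0r invrN mulrN oppr_gt0.
  apply: contraNneq hzS2; rewrite /Dden => D0; apply/eqP; lra.
have [l [u [lu0 [lug lumax]]]] := maximal_interval (near_good hrho hp hq good0).
exists l, u; do 3![split => //].
have iff := conservation_iff_ode hrho hp hq lu0 lug.
split; first exact: iff.
move=> /iff ode x lux; exact: (einstein_metric hrho hp hq lu0 lug ode lux).
Qed.
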